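(* Let $S=\{(0,y,0):y\in\mathbb R\}\subset\mathbb R^3$ in coordinates $(x,y,\theta)$. Let $C_1,C_2,C_3\in\mathbb R$ with $C_1\neq0$ and $C_2C_3\neq0$, and let $c(t)=(x(t),y(t),\theta(t))$ be the local minimizer $$x=\frac1{C_1}\bigl(C_3-C_2\sin(C_1t)-C_3\cos(C_1t)\bigr),$$ $$y=\frac1{4C_1^2}\bigl(2C_1(C_2^2+C_3^2)t-4C_2C_3\cos(C_1t)+2C_2C_3\cos(2C_1t)-4C_2^2\sin(C_1t)+(C_2^2-C_3^2)\sin(2C_1t)+2C_2C_3\bigr),$$ $$\theta=\frac1{C_1}\bigl(C_2-C_2\cos(C_1t)+C_3\sin(C_1t)\bigr).$$ Then $c$ intersects $S$ at the point $\bigl(0,\frac{\pi(C_2^2+C_3^2)}{C_1^2},0\bigr)$ at the time $t=\frac{2\pi}{C_1}$, and it is the first point with this property: $c(t)\notin S$ for all $t$ strictly between $0$ and $\frac{2\pi}{C_1}$. Moreover, for each such $c(t)$ there is a one-parametric family of local minimizers, parametrized by $s\in\mathbb R$, given as the orbit of $c(t)$ with respect to the action of the flow of $t_0=\theta\,\partial_x+\frac{\theta^2-x^2}{2}\,\partial_y-x\,\partial_\theta$; that is, for every $s$ the curve $t\mapsto \mathrm{Fl}^{t_0}_s(c(t))$ is a local minimizer.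
   Context: On $N=\mathbb R^3$ with coordinates $(x,y,\theta)$ consider the sub-Riemannian structure $(N,\mathcal N,r)$ with $\mathcal N=\langle n_1,n_2\rangle$, $n_1=\partial_\theta$, $n_2=\partial_x+\theta\,\partial_y$ orthonormal for $r=dx^2+d\theta^2$. A local minimizer means the projection to $N$ of a normal extremal, i.e. a curve $(x,y,\theta)(t)$ for which there exist functions $h_1,h_2,h_3$ with $$\dot h_1=-h_3h_2,\quad \dot h_2=h_3h_1,\quad \dot h_3=0,\qquad \dot x=h_2,\quad \dot y=\theta h_2,\quad \dot\theta=h_1 .$$ The constants $C_1,C_2,C_3$ correspond to $h_1=C_2\sin(C_1t)+C_3\cos(C_1t)$, $h_2=C_3\sin(C_1t)-C_2\cos(C_1t)$, $h_3=C_1$. $\mathrm{Fl}^{t_0}_s$ denotes the flow of $t_0$ at time $s$, and $S$ is the set of points fixed by this flow. *)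

(* Defs.v *)
From Stdlib Require Import Reals.
From Coquelicot Require Import Coquelicot.
Open Scope R_scope.

(* A point ((x, y), theta) of N = R^3; a tangent vector uses the same order of
   components with respect to (d/dx, d/dy, d/dtheta). *)
Definition point : Type := (R * R * R)%type.

Definition x_ (p : point) : R := fst (fst p).
Definition y_ (p : point) : R := snd (fst p).
Definition theta_ (p : point) : R := snd p.

Definition has_velocity (c : R -> point) (t : R) (v : point) : Prop :=
  is_derive (fun u => x_ (c u)) t (x_ v) /\
  is_derive (fun u => y_ (c u)) t (y_ v) /\
  is_derive (fun u => theta_ (c u)) t (theta_ v).

(* The last conjunct says that c' = h1 n1 + h2 n2, where n1 = d/dtheta and
   n2 = d/dx + theta d/dy. *)
Definition normal_extremal (h1 h2 h3 : R -> R) (c : R -> point) : Prop :=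
  forall t : R,
    is_derive h1 t (- h3 t * h2 t) /\
    is_derive h2 t (h3 t * h1 t) /\
    is_derive h3 t 0 /\
    has_velocity c t (h2 t, theta_ (c t) * h2 t, h1 t).

Definition local_minimizer (c : R -> point) : Prop :=
  exists h1 h2 h3 : R -> R, normal_extremal h1 h2 h3 c.

Definition is_flow (V : point -> point) (Fl : R -> point -> point) : Prop :=
  forall p : point,
    Fl 0 p = p /\
    forall s : R, has_velocity (fun u => Fl u p) s (V (Fl s p)).

Definition t0 (p : point) : point :=
  (theta_ p, (theta_ p ^ 2 - x_ p ^ 2) / 2, - x_ p).

Definition S_axis (p : point) : Prop := exists y : R, p = (0, y, 0).

Definition curve (C1 C2 C3 t : R) : point :=
  (1 / C1 * (C3 - C2 * sin (C1 * t) - C3 * cos (C1 * t)),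
   1 / (4 * C1 ^ 2) *
     (2 * C1 * (C2 ^ 2 + C3 ^ 2) * t
      - 4 * C2 * C3 * cos (C1 * t)
      + 2 * C2 * C3 * cos (2 * C1 * t)
      - 4 * C2 ^ 2 * sin (C1 * t)
      + (C2 ^ 2 - C3 ^ 2) * sin (2 * C1 * t)
      + 2 * C2 * C3),
   1 / C1 * (C2 - C2 * cos (C1 * t) + C3 * sin (C1 * t))).

(* Main.v *)
Require Import Defs.
From Stdlib Require Import Reals Lra FunctionalExtensionality.
From Coquelicot Require Import Coquelicot.
Open Scope R_scope.

(** The structure is the Heisenberg one in disguise: in the variable
    [y - x * theta / 2] the contact form [dy - theta dx] becomes
    [d (y - x theta / 2) + (x dtheta - theta dx) / 2], which is visibly invariant
    under rotations of the [(x, theta)]-plane that fix [y - x * theta / 2].  The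
    flow of [t0] is exactly this group of rotations ([t0_rotation_is_flow]), and
    it is the only flow of [t0] because rotating the solution back, and
    subtracting [x * theta / 2] from its [y]-component, gives three first
    integrals ([t0_flow_unique]).  Rotating the covector [(h1, h2)] along with the
    curve and keeping [h3] solves the equations of normal extremals again, so
    every rotation maps local minimizers to local minimizers
    ([t0_rotation_normal_extremal]).

    As for the first return to the axis, the projection of [c] to the
    [(x, theta)]-plane runs once around a circle through the origin while
    [C1 * t] goes from [0] to [2 * PI], and it meets the origin only if
    [(C2 ^ 2 + C3 ^ 2) * (1 - cos (C1 * t)) = 0] ([curve_S_axis_cos]). *)

(** * The flow of the symmetry [t0] *)

Definition t0_rotation (s : R) (p : point) : point :=
  let X := x_ p * cos s + theta_ p * sin s in
  let Th := theta_ p * cos s - x_ p * sin s in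
  (X, y_ p + (X * Th - x_ p * theta_ p) / 2, Th).

Lemma t0_rotation_is_flow : is_flow t0 t0_rotation.
Proof.
  intros [[x y] th]; split.
  - unfold t0_rotation, x_, y_, theta_; simpl.
    rewrite cos_0, sin_0; repeat apply f_equal2; field.
  - intros s; unfold has_velocity, t0_rotation, t0, x_, y_, theta_; simpl.
    (split; [| split]); auto_derive; trivial; field.
Qed.

(** The eta-expanded form is the one in which [auto_derive] leaves the derivative
    of an unknown function. *)
Lemma Derive_eta_unique (f : R -> R) (t l : R) :
  is_derive f t l -> Derive (fun u => f u) t = l.
Proof. apply is_derive_unique. Qed.

Lemma is_derive_0_const (f : R -> R) :
  (forall s, is_derive f s 0) -> forall s, f s = f 0.
Proof.
  intros Hf s.
  destruct (MVT_gen f 0 s (fun _ => 0)) as [u [_ Hu]].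
  - intros v _; apply Hf.
  - intros v _; apply continuity_pt_filterlim.
    apply (ex_derive_continuous f); exists 0; apply Hf.
  - lra.
Qed.

(** The first integrals of [t0] used here are the position rotated back by the
    angle [s], and the rotation-invariant height [y - x * theta / 2]. *)
Lemma t0_flow_unique (Fl : R -> point -> point) :
  is_flow t0 Fl -> forall s p, Fl s p = t0_rotation s p.
Proof.
  intros HFl s p.
  destruct (HFl p) as [H0 HV].
  set (X u := x_ (Fl u p)); set (Y u := y_ (Fl u p));
    set (T u := theta_ (Fl u p)).
  assert (HX : forall u, is_derive X u (T u)) by (intros u; apply HV).
  assert (HY : forall u, is_derive Y u ((T u ^ 2 - X u ^ 2) / 2))
    by (intros u; apply HV).
  assert (HT : forall u, is_derive T u (- X u)) by (intros u; apply HV).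
  assert (IX : X s * cos s - T s * sin s = X 0 * cos 0 - T 0 * sin 0).
  { apply (is_derive_0_const (fun u => X u * cos u - T u * sin u)); intros u.
    auto_derive.
    - split; [eexists; apply HX | split; [eexists; apply HT | trivial]].
    - rewrite (Derive_eta_unique _ _ _ (HX u)), (Derive_eta_unique _ _ _ (HT u)).
      ring. }
  assert (IT : X s * sin s + T s * cos s = X 0 * sin 0 + T 0 * cos 0).
  { apply (is_derive_0_const (fun u => X u * sin u + T u * cos u)); intros u.
    auto_derive.
    - split; [eexists; apply HX | split; [eexists; apply HT | trivial]].
    - rewrite (Derive_eta_unique _ _ _ (HX u)), (Derive_eta_unique _ _ _ (HT u)).
      ring. }
  assert (IY : Y s - X s * T s / 2 = Y 0 - X 0 * T 0 / 2).
  { apply (is_derive_0_const (fun u => Y u - X u * T u / 2)); intros u.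
    auto_derive.
    - split; [eexists; apply HY |
        split; [eexists; apply HX | split; [eexists; apply HT | trivial]]].
    - rewrite (Derive_eta_unique _ _ _ (HX u)), (Derive_eta_unique _ _ _ (HT u)),
        (Derive_eta_unique _ _ _ (HY u)).
      field. }
  rewrite cos_0, sin_0 in IX, IT.
  assert (Hp : X 0 = x_ p /\ Y 0 = y_ p /\ T 0 = theta_ p)
    by (unfold X, Y, T; rewrite H0; auto).
  destruct Hp as [HX0 [HY0 HT0]].
  rewrite HX0, HT0 in IX, IT; rewrite HX0, HY0, HT0 in IY.
  pose proof (sin2_cos2 s) as SC; unfold Rsqr in SC.
  assert (RX : X s = x_ p * cos s + theta_ p * sin s).
  { replace (X s) with (X s * (sin s * sin s + cos s * cos s))
      by (rewrite SC; ring).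
    replace (x_ p) with (X s * cos s - T s * sin s) by lra.
    replace (theta_ p) with (X s * sin s + T s * cos s) by lra.
    ring. }
  assert (RT : T s = theta_ p * cos s - x_ p * sin s).
  { replace (T s) with (T s * (sin s * sin s + cos s * cos s))
      by (rewrite SC; ring).
    replace (x_ p) with (X s * cos s - T s * sin s) by lra.
    replace (theta_ p) with (X s * sin s + T s * cos s) by lra.
    ring. }
  unfold t0_rotation; cbv zeta; rewrite <- RX, <- RT.
  replace (y_ p + (X s * T s - x_ p * theta_ p) / 2) with (Y s) by lra.
  unfold X, Y, T; destruct (Fl s p) as [[a b] c]; reflexivity.
Qed.

(** * The action of the flow on normal extremals *)

(** The covector turns by the same angle as the position.  The [y]-equation is
    preserved because [theta * h2 - x * h1] is the determinant of the two vectors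
    [(theta, x)] and [(h1, h2)], hence invariant under their common rotation. *)
Lemma t0_rotation_normal_extremal (h1 h2 h3 : R -> R) (c : R -> point) (s : R) :
  normal_extremal h1 h2 h3 c ->
  normal_extremal (fun t => h1 t * cos s - h2 t * sin s)
    (fun t => h2 t * cos s + h1 t * sin s) h3 (fun t => t0_rotation s (c t)).
Proof.
  intros Hc t; destruct (Hc t) as [H1 [H2 [H3 HV]]].
  unfold has_velocity in HV; simpl in HV; destruct HV as [HX [HY HT]].
  unfold has_velocity, t0_rotation; cbn [x_ y_ theta_ fst snd].
  set (X u := x_ (c u)) in *; set (Y u := y_ (c u)) in *;
    set (T u := theta_ (c u)) in *.
  change (is_derive X t (h2 t)) in HX.
  change (is_derive Y t (T t * h2 t)) in HY.
  change (is_derive T t (h1 t)) in HT.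
  assert (E1 : ex_derive h1 t) by (eexists; apply H1).
  assert (E2 : ex_derive h2 t) by (eexists; apply H2).
  assert (EX : ex_derive X t) by (eexists; apply HX).
  assert (EY : ex_derive Y t) by (eexists; apply HY).
  assert (ET : ex_derive T t) by (eexists; apply HT).
  split; [| split; [| split; [exact H3 | split; [| split]]]].
  - auto_derive; [tauto |].
    rewrite (Derive_eta_unique _ _ _ H1), (Derive_eta_unique _ _ _ H2); ring.
  - auto_derive; [tauto |].
    rewrite (Derive_eta_unique _ _ _ H1), (Derive_eta_unique _ _ _ H2); ring.
  - change (is_derive (fun u => X u * cos s + T u * sin s) t
      (h2 t * cos s + h1 t * sin s)).
    auto_derive; [tauto |].
    rewrite (Derive_eta_unique _ _ _ HX), (Derive_eta_unique _ _ _ HT); ring.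
  - change (is_derive
      (fun u => Y u + ((X u * cos s + T u * sin s) * (T u * cos s - X u * sin s)
                       - X u * T u) / 2) t
      ((T t * cos s - X t * sin s) * (h2 t * cos s + h1 t * sin s))).
    auto_derive; [tauto |].
    rewrite (Derive_eta_unique _ _ _ HX), (Derive_eta_unique _ _ _ HT),
      (Derive_eta_unique _ _ _ HY).
    pose proof (sin2_cos2 s) as SC; unfold Rsqr in SC.
    apply Rminus_diag_uniq.
    (* The difference of the two sides is half the determinant, times
       [1 - (sin s ^ 2 + cos s ^ 2)]. *)
    transitivity ((T t * h2 t - X t * h1 t) / 2
                  * (1 - (sin s * sin s + cos s * cos s))); [field |].
    rewrite SC; ring.
  - change (is_derive (fun u => T u * cos s - X u * sin s) t
      (h1 t * cos s - h2 t * sin s)).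
    auto_derive; [tauto |].
    rewrite (Derive_eta_unique _ _ _ HX), (Derive_eta_unique _ _ _ HT); ring.
Qed.

(** * The curve and its first return to the axis *)

Lemma curve_normal_extremal (C1 C2 C3 : R) (hC1 : C1 <> 0) :
  normal_extremal
    (fun t => C2 * sin (C1 * t) + C3 * cos (C1 * t))
    (fun t => C3 * sin (C1 * t) - C2 * cos (C1 * t))
    (fun _ => C1)
    (curve C1 C2 C3).
Proof.
  intros t; unfold has_velocity, curve, x_, y_, theta_; simpl.
  split; [| split; [| split; [| split; [| split]]]].
  - auto_derive; trivial; ring.
  - auto_derive; trivial; ring.
  - auto_derive; trivial; ring.
  - auto_derive; trivial; field; assumption.
  - auto_derive; trivial.
    replace (2 * C1 * t) with (2 * (C1 * t)) by ring.
    rewrite sin_2a, cos_2a.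
    pose proof (sin2_cos2 (C1 * t)) as SC; unfold Rsqr in SC.
    set (si := sin (C1 * t)) in *; set (co := cos (C1 * t)) in *.
    apply Rminus_diag_uniq.
    (* After the double-angle formulas the two sides agree up to a multiple of
       [sin ^ 2 + cos ^ 2 - 1]; the factor collects the constant terms. *)
    transitivity ((C2 ^ 2 + C3 ^ 2) / (2 * C1) * (1 - (si * si + co * co)));
      [field; assumption |].
    rewrite SC; ring.
  - auto_derive; trivial; field; assumption.
Qed.

Lemma curve_period (C1 C2 C3 : R) (hC1 : C1 <> 0) :
  curve C1 C2 C3 (2 * PI / C1) = (0, PI * (C2 ^ 2 + C3 ^ 2) / C1 ^ 2, 0).
Proof.
  unfold curve.
  replace (C1 * (2 * PI / C1)) with (2 * PI) by (field; assumption).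
  replace (2 * C1 * (2 * PI / C1)) with (2 * (2 * PI)) by (field; assumption).
  rewrite (sin_2a (2 * PI)), (cos_2a (2 * PI)), sin_2PI, cos_2PI.
  f_equal; [f_equal |]; field; assumption.
Qed.

Lemma curve_S_axis_cos (C1 C2 C3 t : R) :
  C1 <> 0 -> C2 <> 0 -> S_axis (curve C1 C2 C3 t) -> cos (C1 * t) = 1.
Proof.
  intros hC1 hC2 [y Hy]; unfold curve in Hy.
  injection Hy as Hx _ Hth.
  set (si := sin (C1 * t)) in *; set (co := cos (C1 * t)) in *.
  assert (Kx : C3 - C2 * si - C3 * co = 0).
  { replace (C3 - C2 * si - C3 * co)
      with (C1 * (1 / C1 * (C3 - C2 * si - C3 * co))) by (field; assumption).
    rewrite Hx; ring. }
  assert (Kth : C2 - C2 * co + C3 * si = 0).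
  { replace (C2 - C2 * co + C3 * si)
      with (C1 * (1 / C1 * (C2 - C2 * co + C3 * si))) by (field; assumption).
    rewrite Hth; ring. }
  (* This combination of the two equations eliminates the sine. *)
  assert (K : (C2 ^ 2 + C3 ^ 2) * (1 - co) = 0).
  { transitivity (C3 * (C3 - C2 * si - C3 * co) + C2 * (C2 - C2 * co + C3 * si));
      [ring | rewrite Kx, Kth; ring]. }
  pose proof (pow2_gt_0 C2 hC2); pose proof (pow2_ge_0 C3).
  apply Rmult_integral in K; destruct K; lra.
Qed.

Lemma cos_lt_1 (u : R) : 0 < u < 2 * PI -> cos u < 1.
Proof.
  intros Hu.
  replace u with (2 * (u / 2)) by field.
  rewrite cos_2a_sin.
  assert (Hs : 0 < sin (u / 2)) by (apply sin_gt_0; lra).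
  pose proof (Rmult_lt_0_compat _ _ Hs Hs); lra.
Qed.

(** [C1] may have either sign; rescaling time by it brings both cases to the
    same interval of angles. *)
Lemma between_period_angle (C1 t : R) (hC1 : C1 <> 0) :
  Rmin 0 (2 * PI / C1) < t < Rmax 0 (2 * PI / C1) -> 0 < C1 * t < 2 * PI.
Proof.
  pose proof PI_RGT_0 as HPI.
  assert (E : C1 * (2 * PI / C1) = 2 * PI) by (field; assumption).
  set (P := 2 * PI / C1) in *; rewrite <- E.
  unfold Rmin, Rmax; destruct (Rle_dec 0 P) as [HP | HP]; intros [H1 H2].
  - assert (0 < C1) by nra; split; nra.
  - assert (C1 < 0) by nra; split; nra.
Qed.

Theorem proposition4p4 (C1 C2 C3 : R) (hC1 : C1 <> 0) (hC23 : C2 * C3 <> 0) :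
  normal_extremal
    (fun t => C2 * sin (C1 * t) + C3 * cos (C1 * t))
    (fun t => C3 * sin (C1 * t) - C2 * cos (C1 * t))
    (fun _ => C1)
    (curve C1 C2 C3) /\
  curve C1 C2 C3 (2 * PI / C1) = (0, PI * (C2 ^ 2 + C3 ^ 2) / C1 ^ 2, 0) /\
  S_axis (curve C1 C2 C3 (2 * PI / C1)) /\
  (forall t : R,
     Rmin 0 (2 * PI / C1) < t < Rmax 0 (2 * PI / C1) ->
     ~ S_axis (curve C1 C2 C3 t)) /\
  (exists Fl : R -> point -> point, is_flow t0 Fl) /\
  (forall Fl : R -> point -> point, is_flow t0 Fl ->
     forall s : R, local_minimizer (fun t => Fl s (curve C1 C2 C3 t))).
Proof.
  pose proof (curve_normal_extremal C1 C2 C3 hC1) as Hext.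
  split; [exact Hext |].
  split; [apply curve_period; assumption |].
  split; [eexists; apply curve_period; assumption |].
  split; [| split].
  - intros t Ht HS.
    assert (hC2 : C2 <> 0) by (intros E; apply hC23; rewrite E; ring).
    pose proof (curve_S_axis_cos _ _ _ _ hC1 hC2 HS).
    pose proof (cos_lt_1 _ (between_period_angle _ _ hC1 Ht)); lra.
  - exists t0_rotation; apply t0_rotation_is_flow.
  - intros Fl HFl s.
    replace (fun t => Fl s (curve C1 C2 C3 t))
      with (fun t => t0_rotation s (curve C1 C2 C3 t)).
    + eexists _, _, _; apply t0_rotation_normal_extremal, Hext.
    + apply functional_extensionality; intros t; symmetry.
      apply t0_flow_unique; assumption.
Qed.
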